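(* Let $E\subseteq\mathbb C$ be a domain and let $H_K(E)$ be a reproducing kernel Hilbert space on $E$ whose kernel $K(q,\overline p)$ is holomorphic in $q$ and anti-holomorphic in $p$. Let $f\in H_K(E)$, let $n\ge 1$, and let $p_1,\dots,p_n\in E$ be fixed (not necessarily distinct). If $$\lim_{p_{n+1}\to\partial E}\frac{|\langle f,\widetilde K(\cdot,\overline{p}_{n+1})\rangle|}{\sqrt{a_{n+1,n+1}}}=0$$ and $$\lim_{p_{n+1}\to\partial E}\frac{|a_{j,n+1}|}{\sqrt{a_{n+1,n+1}}}=0,\qquad j=1,2,\dots,n,$$ then $$\lim_{p_{n+1}\to\partial E}\|f-f^*_{A_{n+1}}\|=\|f-f^*_{A_n}\|,$$ where $a_{j,k}$, $\widetilde K$, $A_n$, $A_{n+1}$, $f^*_{A_n}$ and $f^*_{A_{n+1}}$ are formed from the sequences $(p_1,\dots,p_n)$ and $(p_1,\dots,p_n,p_{n+1})$ as defined in the context.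
   Context: $H_K(E)$ is the reproducing kernel Hilbert space of complex functions on $E$ with kernel $K$: for each $p\in E$, $k_p:=K(\cdot,\overline p)\in H_K(E)$ and $\langle g,K(\cdot,\overline p)\rangle=g(p)$ for all $g\in H_K(E)$. The norm and inner product are those of $H_K(E)$. For a finite sequence $(p_1,\dots,p_n)$ of points of $E$, repetitions allowed, let $m_k$ be the cardinality of $\{j: p_j=p_k,\ j<k\}$ and put $$\widetilde K(\cdot,\overline{p}_k)=\frac{d^{m_k}}{d(\overline p)^{m_k}}\,k_p\Big|_{p=p_k}.$$ Thus $\langle g,\widetilde K(\cdot,\overline p_k)\rangle=g^{(m_k)}(p_k)$. Let $A_n=(a_{j,k})_{n\times n}$ with $$a_{j,k}=\langle \widetilde K(\cdot,\overline p_k),\widetilde K(\cdot,\overline p_j)\rangle .$$ Standing assumption: for every finite sequence of points of $E$ (repetitions allowed) the elements $\widetilde K(\cdot,\overline p_1),\dots,\widetilde K(\cdot,\overline p_n)$ are linearly independent, i.e. $A_n$ is positive definite. Define $$f^*_{A_n}=\sum_{j=1}^n\sum_{k=1}^n\langle f,\widetilde K(\cdot,\overline p_j)\rangle\,\widetilde{a^{(n)}_{j,k}}\,\widetilde K(\cdot,\overline p_k),$$ where $\widetilde{a^{(n)}_{j,k}}$ is the $(j,k)$ entry of $\overline{A_n^{-1}}$ (entrywise complex conjugate of the inverse of $A_n$). $f^*_{A_{n+1}}$ is defined in the same way from $(p_1,\dots,p_n,p_{n+1})$. The limit $p_{n+1}\to\partial E$ means that $p_{n+1}\in E$ eventually leaves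 every compact subset of $E$; if $E$ is unbounded, the point at infinity is counted as part of $\partial E$ (for $E=\mathbb C$ this is $|p_{n+1}|\to\infty$). *)

(* Defs.v *)
From HB Require Import structures.
From mathcomp Require Import all_boot all_order all_algebra.
From mathcomp Require Import complex.
From mathcomp Require Import all_classical all_reals all_analysis.
Set Implicit Arguments.
Unset Strict Implicit.
Unset Printing Implicit Defensive.
Import Order.TTheory GRing.Theory Num.Theory.
Import numFieldNormedType.Exports.
Local Open Scope classical_set_scope.
Local Open Scope ring_scope.

(* R[i] itself carries no topology in the library; seen as a
   numClosedFieldType it inherits the one given by the modulus.  Moduli and
   norms are then elements of Cplx R (nonnegative reals in Cplx R). *)
Definition Cplx (R : realType) : numClosedFieldType := R[i].

Section ComplexDomains.
Variable R : realType.
Local Notation C := (Cplx R).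

Definition domain (E : set C) : Prop :=
  [/\ open E, connected E & E !=set0].

Definition holomorphic_on (E : set C) (f : C -> C) : Prop :=
  forall z, E z -> derivable f z 1.

Definition antiholomorphic_on (E : set C) (f : C -> C) : Prop :=
  holomorphic_on E (fun z => (f z)^*).

(* The value at p of d^m F / d(\bar p)^m: F, read as a function of
   w = \bar p, is differentiated m times in the complex variable w. *)
Definition dconjn (V : normedModType C) (m : nat) (F : C -> V) (p : C) : V :=
  derive1n m (fun w : C => F w^*) p^*.

(* The filter of "z in E eventually leaves every compact subset of E"; for
   unbounded E this includes z tending to infinity inside E. *)
Definition to_boundary (E : set C) : set_system C :=
  filter_from [set L : set C | compact L /\ L `<=` E] (fun L => E `\` L).

Global Instance to_boundary_filter (E : set C) : Filter (to_boundary E).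
Proof.
apply: filter_from_filter; first by exists set0; split=> //; exact: compact0.
move=> L M [cL LE] [cM ME]; exists (L `|` M).
  by split; [exact: compactU | move=> z [/LE|/ME]].
by move=> z [Ez /not_orP[nL nM]].
Qed.

End ComplexDomains.

(* H_K(E): a Hilbert space over the complex numbers whose elements are
   identified, through rkhs_eval, with functions on E.  The form rkhs_dot is
   linear in its first and conjugate-linear in its second argument.  The
   kernel is K(q, w) with w = \bar p, so that k_p = K(., \bar p). *)
Record rkhs (R : realType) (E : set (Cplx R))
    (K : Cplx R -> Cplx R -> Cplx R) := RKHS {
  rkhs_space :> completeNormedModType (Cplx R);
  rkhs_dot : {dot rkhs_space for (@Num.conj (Cplx R))};
  rkhs_normE : forall g : rkhs_space, `|g| ^+ 2 = rkhs_dot g g;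
  rkhs_eval : rkhs_space -> Cplx R -> Cplx R;
  rkhs_eval_linear : forall (a : Cplx R) (g h : rkhs_space) (q : Cplx R),
    E q -> rkhs_eval (a *: g + h) q = a * rkhs_eval g q + rkhs_eval h q;
  rkhs_eval_inj : forall g h : rkhs_space,
    (forall q, E q -> rkhs_eval g q = rkhs_eval h q) -> g = h;
  rkhs_k : Cplx R -> rkhs_space;
  rkhs_kE : forall p q : Cplx R, E p -> E q ->
    rkhs_eval (rkhs_k p) q = K q p^*;
  rkhs_reproducing : forall (g : rkhs_space) (p : Cplx R), E p ->
    rkhs_dot g (rkhs_k p) = rkhs_eval g p
}.

Section GramProjection.
Variables (R : realType) (E : set (Cplx R)) (K : Cplx R -> Cplx R -> Cplx R).
Variable H : rkhs E K.
Local Notation C := (Cplx R).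
Local Notation "''[' u , v ]" := (@rkhs_dot R E K H u v) : ring_scope.

Definition multiplicity n (p : n.-tuple C) (k : 'I_n) : nat :=
  #|[pred j : 'I_n | (tnth p j == tnth p k) && (j < k)%N]|.

Definition Ktilde n (p : n.-tuple C) (k : 'I_n) : H :=
  dconjn (multiplicity p k) (@rkhs_k R E K H) (tnth p k).

Definition gram n (p : n.-tuple C) : 'M[C]_n :=
  \matrix_(j, k) '[Ktilde p k, Ktilde p j].

Definition fstar (f : H) n (p : n.-tuple C) : H :=
  \sum_(j < n) \sum_(k < n)
    ('[f, Ktilde p j] * (invmx (gram p) j k)^*) *: Ktilde p k.

Definition Ktilde_independent : Prop :=
  forall n (p : n.-tuple C), (forall k, E (tnth p k)) ->
  forall c : 'I_n -> C, \sum_(k < n) c k *: Ktilde p k = 0 ->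
  forall k, c k = 0.

End GramProjection.

(* Main.v *)
(* The matrix formula makes [f*_{A_n}] the orthogonal projection of [f] onto the
   span of the [Ktilde p_k].  With [r = f - f*_{A_n}], [e = Ktilde p_{n+1}] and
   [u] the component of [e] orthogonal to the first [n] vectors, passing to
   [n+1] changes the projection by a vector of norm [|<r, e>| / |u|].  After
   division by [|e| = sqrt a_{n+1,n+1}] the numerator is at most
   [|<f, e>| / |e| + O(max_j |a_{j,n+1}| / |e|)], which tends to 0, and the
   denominator is at least [1 - O(max_j |a_{j,n+1}| / |e|)].  The
   triangle inequality transfers this to the norms. *)

Require Import Defs.
From HB Require Import structures.
From mathcomp Require Import all_boot all_order all_algebra.
From mathcomp Require Import complex.
From mathcomp Require Import all_classical all_reals all_analysis.
Set Implicit Arguments.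
Unset Strict Implicit.
Unset Printing Implicit Defensive.
Import Order.TTheory GRing.Theory Num.Theory.
Import numFieldNormedType.Exports.
Local Open Scope classical_set_scope.
Local Open Scope ring_scope.

(** * Orthogonal projection through the Gram matrix of a finite independent family *)

Section OrthogonalProjection.
Variables (C : numClosedFieldType) (V : normedModType C).
Variable dot : {dot V for (@Num.conj C)}.
Hypothesis normE : forall g : V, `|g| ^+ 2 = dot g g.
Local Notation "''[' u , v ]" := (dot u v) : ring_scope.

Definition lin_indep n (e : 'I_n -> V) : Prop :=
  forall c : 'I_n -> C, \sum_k c k *: e k = 0 -> forall k, c k = 0.

(** With [gram_proj], an abstract copy of [gram] and [fstar] for an arbitrary family. At
    [e = Ktilde H p] the two versions agree by unfolding alone. *)
Definition gram_mx n (e : 'I_n -> V) : 'M[C]_n := \matrix_(j, k) '[e k, e j].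

Definition gram_proj n (e : 'I_n -> V) (g : V) : V :=
  \sum_j \sum_k ('[g, e j] * (invmx (gram_mx e) j k)^*) *: e k.

Definition gram_coef n (e : 'I_n -> V) (g : V) (k : 'I_n) : C :=
  \sum_j '[g, e j] * (invmx (gram_mx e) j k)^*.

Lemma dotBl u v w : '[u - v, w] = '[u, w] - '[v, w].
Proof. exact: linearBl. Qed.

Lemma dotBr u v w : '[w, u - v] = '[w, u] - '[w, v].
Proof. exact: linearBr. Qed.

Lemma dotZl a u v : '[a *: u, v] = a * '[u, v].
Proof. exact: linearZl_LR. Qed.

Lemma dotC u v : '[u, v] = ('[v, u])^*.
Proof. by rewrite hermC expr0 mul1r. Qed.

Lemma normC_dot u v : `|'[u, v]| = `|'[v, u]|.
Proof. by rewrite dotC norm_conjC. Qed.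

Lemma dot_suml n (c : 'I_n -> C) (e : 'I_n -> V) v :
  '[\sum_k c k *: e k, v] = \sum_k c k * '[e k, v].
Proof. by rewrite linear_sumlz; apply: eq_bigr => k _; exact: dotZl. Qed.

Lemma dot_sumr n (c : 'I_n -> C) (e : 'I_n -> V) v :
  '[v, \sum_k c k *: e k] = \sum_k (c k)^* * '[v, e k].
Proof. by rewrite linear_sumr; apply: eq_bigr => k _; rewrite linearZr_LR. Qed.

Lemma dot_self_eq0 u : '[u, u] = 0 -> u = 0.
Proof. by move/eqP; rewrite dnorm_eq0 => /eqP. Qed.

Lemma norm_sqrt_dot u : `|u| = sqrtC '[u, u].
Proof. by rewrite -normE sqrCK. Qed.

Lemma dot_orth_span n (c : 'I_n -> C) (e : 'I_n -> V) g :
  (forall l, '[g, e l] = 0) -> '[g, \sum_k c k *: e k] = 0.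
Proof.
by move=> ge; rewrite dot_sumr big1 // => k _; rewrite ge mulr0.
Qed.

Lemma gram_projE n (e : 'I_n -> V) g :
  gram_proj e g = \sum_k gram_coef e g k *: e k.
Proof.
rewrite /gram_proj exchange_big /=; apply: eq_bigr => k _.
by rewrite scaler_suml.
Qed.

(** If [v] is in the left kernel, the combination of the [e j] with coefficients [(v 0 j)^*] is
    orthogonal to every [e k], hence to itself, so it vanishes. *)
Lemma gram_mx_unit n (e : 'I_n -> V) : lin_indep e -> gram_mx e \in unitmx.
Proof.
move=> ie; rewrite -row_free_unit; apply: inj_row_free => v vG.
have vw k : '[e k, \sum_j (v 0 j)^* *: e j] = 0.
  have := congr1 (fun w : 'rV_n => w 0 k) vG; rewrite mxE [RHS]mxE => vGk.
  rewrite dot_sumr -[RHS]vGk.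
  by apply: eq_bigr => j _; rewrite mxE conjCK.
have /ie v0 : \sum_j (v 0 j)^* *: e j = 0.
  by apply: dot_self_eq0; rewrite dot_suml big1 // => k _; rewrite vw mulr0.
by apply/rowP => j; rewrite mxE -[LHS]conjCK v0 conjC0.
Qed.

(** Since ['[e k, e l]] is the conjugate of the [(k, l)] Gram entry, the sum over [k] is a
    conjugated entry of (inverse times Gram matrix), a Kronecker delta. This is why the inverse is
    conjugated in the formula. *)
Lemma gram_proj_orth n (e : 'I_n -> V) g l : lin_indep e ->
  '[g - gram_proj e g, e l] = 0.
Proof.
move=> ie; rewrite dotBl gram_projE /= dot_suml.
under eq_bigr do rewrite /gram_coef mulr_suml.
rewrite exchange_big /=.
have VG j : \sum_k (invmx (gram_mx e) j k)^* * '[e k, e l] = (j == l)%:R.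
  have := congr1 (fun M : 'M[C]_n => (M j l)^*) (mulVmx (gram_mx_unit ie)).
  rewrite !mxE conjC_nat rmorph_sum => <-.
  by apply: eq_bigr => k _; rewrite rmorphM /= mxE -dotC.
under eq_bigr => j _.
  under eq_bigr do rewrite -mulrA.
  rewrite -mulr_sumr VG; over.
rewrite (bigD1 l) //= eqxx mulr1 big1 ?addr0 ?subrr // => j /negPf->.
by rewrite mulr0.
Qed.

(** The difference of the two candidates lies in the span and is orthogonal to it, hence to
    itself. *)
Lemma gram_proj_unique n (e : 'I_n -> V) (c : 'I_n -> C) g : lin_indep e ->
  (forall l, '[g - \sum_k c k *: e k, e l] = 0) ->
  gram_proj e g = \sum_k c k *: e k.
Proof.
move=> ie gc; apply/eqP; rewrite -subr_eq0; apply/eqP.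
have dE : gram_proj e g - \sum_k c k *: e k =
    \sum_k (gram_coef e g k - c k) *: e k.
  by rewrite gram_projE -sumrB; apply: eq_bigr => k _; rewrite scalerBl.
apply: dot_self_eq0; rewrite [X in '[_, X]]dE; apply: dot_orth_span => l.
have -> : gram_proj e g - \sum_k c k *: e k =
    (g - \sum_k c k *: e k) - (g - gram_proj e g).
  by rewrite opprB [RHS]addrC addrA subrK.
by rewrite dotBl gc gram_proj_orth // subr0.
Qed.

(** * Adding one vector to the family, and bounds on residuals *)

Lemma lift_ord_max n (j : 'I_n) : lift ord_max j = widen_ord (leqnSn n) j.
Proof. by apply: val_inj; rewrite /= /bump leqNgt ltn_ord. Qed.

Lemma coef_recr n (c : 'I_n -> C) (a : C) : exists d : 'I_n.+1 -> C,
  d ord_max = a /\ forall j, d (widen_ord (leqnSn n) j) = c j.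
Proof.
exists (fun i => if unlift ord_max i is Some j then c j else a).
by split=> [|j]; rewrite ?unlift_none // -lift_ord_max liftK.
Qed.

Lemma lin_indep_widen n (e : 'I_n.+1 -> V) :
  lin_indep e -> lin_indep (fun k => e (widen_ord (leqnSn n) k)).
Proof.
move=> ie c c0 k; have [d [d_max dw]] := coef_recr c 0.
rewrite -dw; apply: ie; rewrite big_ord_recr /= d_max scale0r addr0 -[RHS]c0.
by apply: eq_bigr => j _; rewrite dw.
Qed.

(** The new projection is the old one plus the projection of [r] onto the line of [u]. The product
    form avoids division, so a lower bound for [|u|] can be inserted directly. *)
Lemma gram_proj_recr_dist n (e : 'I_n.+1 -> V) g
    (e' := fun k => e (widen_ord (leqnSn n) k))
    (r := g - gram_proj e' g) (u := e ord_max - gram_proj e' (e ord_max)) :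
  lin_indep e ->
  `| `|g - gram_proj e g| - `|r| | * `|u| <= `|'[r, e ord_max]|.
Proof.
move=> ie.
have ie' : lin_indep e' by exact: lin_indep_widen.
have rP v : '[r, gram_proj e' v] = 0.
  by rewrite gram_projE; apply: dot_orth_span => l; exact: gram_proj_orth.
have ru : '[r, u] = '[r, e ord_max] by rewrite dotBr rP subr0.
have [u0|u0] := eqVneq u 0.
  by rewrite u0 normr0 mulr0.
have uu : '[u, u] != 0 by rewrite dnorm_eq0.
have ue : '[u, e ord_max] = '[u, u].
  rewrite -[LHS]subr0 -[X in _ - X](_ : '[u, gram_proj e' (e ord_max)] = 0).
    by rewrite -dotBr.
  by rewrite gram_projE; apply: dot_orth_span => l; exact: gram_proj_orth.
pose c := '[r, u] / '[u, u].
have pE : gram_proj e g = gram_proj e' g + c *: u.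
  (* Expanding [u] shows the coefficients of [gram_proj e' g + c *: u]: the last is [c], and the
     others are corrected by [c] times those of the projection of [e ord_max]. *)
  have [d [d_max dw]] :=
    coef_recr (fun j => gram_coef e' g j - c * gram_coef e' (e ord_max) j) c.
  have dE : \sum_k d k *: e k = gram_proj e' g + c *: u.
    rewrite big_ord_recr /= d_max.
    under eq_bigr do rewrite dw scalerBl -scalerA.
    by rewrite sumrB -scaler_sumr -!gram_projE scalerBr addrAC addrA.
  rewrite -dE; apply: gram_proj_unique => // l; rewrite dE opprD addrA -/r.
  rewrite dotBl dotZl /=.
  have [j|] := unliftP ord_max l.
    by move=> ->; rewrite lift_ord_max !gram_proj_orth // mulr0 subrr.
  by move=> ->; rewrite ue -ru divfK // subrr.
apply: (@le_trans _ _ (`|c *: u| * `|u|)).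
  apply: ler_wpM2r => //.
  rewrite distrC; apply: le_trans (ler_dist_dist _ _) _.
  have -> : g - gram_proj e g = r - c *: u by rewrite pE opprD addrA.
  by rewrite opprB addrC subrK.
rewrite normrZ -mulrA -expr2 normE -['[u, u]]ger0_norm ?dnorm_ge0 //.
by rewrite -normrM divfK // ru.
Qed.

(** Here and in [norm_residual_ge], the factors of [|'[v, e j]|] do not involve [v], so they stay
    constant as the last point moves. *)
Lemma dot_residual_le n (e : 'I_n -> V) g v :
  `|'[g - gram_proj e g, v]|
    <= `|'[g, v]| + \sum_j `|gram_coef e g j| * `|'[v, e j]|.
Proof.
rewrite dotBl; apply: le_trans (ler_normB _ _) _; rewrite lerD2l.
rewrite gram_projE dot_suml; apply: le_trans (ler_norm_sum _ _ _) _.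
by apply: ler_sum => j _; rewrite normrM normC_dot.
Qed.

Lemma norm_residual_ge n (e : 'I_n -> V) v :
  `|v| - \sum_j (\sum_k `|invmx (gram_mx e) j k| * `|e k|) * `|'[v, e j]|
    <= `|v - gram_proj e v|.
Proof.
apply: le_trans (lerB_dist _ _); rewrite lerD2l lerN2.
apply: le_trans (ler_norm_sum _ _ _) _; apply: ler_sum => j _.
apply: le_trans (ler_norm_sum _ _ _) _; rewrite mulr_suml.
apply: ler_sum => k _.
by rewrite normrZ normrM norm_conjC [leRHS]mulrC mulrA.
Qed.

End OrthogonalProjection.

(** * Appending a point to the sequence *)

Section KtildeRcons.
Variables (R : realType) (E : set (Cplx R)) (K : Cplx R -> Cplx R -> Cplx R).
Variable H : rkhs E K.

Lemma tnth_rcons_widen n (p : n.-tuple (Cplx R)) z (j : 'I_n) :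
  tnth (rcons_tuple p z) (widen_ord (leqnSn n) j) = tnth p j.
Proof. by rewrite !(tnth_nth 0) /= nth_rcons size_tuple ltn_ord. Qed.

Lemma tnth_rcons_max n (p : n.-tuple (Cplx R)) z :
  tnth (rcons_tuple p z) ord_max = z.
Proof. by rewrite (tnth_nth 0) /= nth_rcons size_tuple ltnn eqxx. Qed.

(** Only earlier indices are counted, so the appended point, even if it repeats an old one, leaves
    the old multiplicities alone. *)
Lemma multiplicity_rcons n (p : n.-tuple (Cplx R)) z (k : 'I_n) :
  multiplicity (rcons_tuple p z) (widen_ord (leqnSn n) k) = multiplicity p k.
Proof.
rewrite /multiplicity -!sum1_card big_mkcond big_ord_recr /= [RHS]big_mkcond /=.
rewrite inE /= [(n < k)%N]ltnNge (ltnW (ltn_ord k)) andbF addn0.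
by apply: eq_bigr => j _; rewrite !inE !tnth_rcons_widen.
Qed.

Lemma Ktilde_rcons n (p : n.-tuple (Cplx R)) z (k : 'I_n) :
  Ktilde H (rcons_tuple p z) (widen_ord (leqnSn n) k) = Ktilde H p k.
Proof. by rewrite /Ktilde multiplicity_rcons tnth_rcons_widen. Qed.

Lemma gramE n (p : n.-tuple (Cplx R)) (j k : 'I_n) :
  gram H p j k = rkhs_dot H (Ktilde H p k) (Ktilde H p j).
Proof. by rewrite mxE. Qed.

End KtildeRcons.

(** * The limit at the boundary *)

Lemma cvg_sum_mul0 (C : numFieldType) (T : Type) (F : set_system T)
    (FF : Filter F) n (c : 'I_n -> C) (h : 'I_n -> T -> C) :
  (forall j, h j @ F --> (0 : C)) ->
  (fun z => \sum_j c j * h j z) @ F --> (0 : C).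
Proof.
move=> h0; rewrite -[X in _ --> X](_ : \sum_j c j * 0 = 0).
  apply: (cvg_big add_continuous) => j _.
  by apply: cvgM; [exact: cvg_cst|exact: h0].
by rewrite big1 // => j _; rewrite mulr0.
Qed.

Theorem lemma2p1 (R : realType) (E : set (Cplx R))
    (K : Cplx R -> Cplx R -> Cplx R) (H : rkhs E K)
    (domE : domain E)
    (holK : forall p, E p -> holomorphic_on E (fun q => K q p^*))
    (aholK : forall q, E q -> antiholomorphic_on E (fun p => K q p^*))
    (indep : Ktilde_independent H)
    (f : H) (n : nat) (n_ge1 : (1 <= n)%N)
    (p : n.-tuple (Cplx R)) (pE : forall j, E (tnth p j))
    (hf : (fun z => let p1 := rcons_tuple p z in
             `|rkhs_dot H f (Ktilde H p1 ord_max)|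
               / sqrtC (gram H p1 ord_max ord_max))
          @ to_boundary E --> (0 : Cplx R))
    (ha : forall j : 'I_n,
          (fun z => let p1 := rcons_tuple p z in
             `|gram H p1 (widen_ord (leqnSn n) j) ord_max|
               / sqrtC (gram H p1 ord_max ord_max))
          @ to_boundary E --> (0 : Cplx R)) :
  (fun z => `|f - fstar f (rcons_tuple p z)|) @ to_boundary E
    --> `|f - fstar f p|.
Proof.
pose e z := Ktilde H (rcons_tuple p z).
have norm_e z k : sqrtC (gram H (rcons_tuple p z) k k) = `|e z k|.
  by rewrite gramE -(norm_sqrt_dot (@rkhs_normE _ _ _ H)).
pose c := gram_coef (rkhs_dot H) (Ktilde H p) f.
pose M j := \sum_k `|invmx (gram H p) j k| * `|Ktilde H p k|.
pose h j z := `|rkhs_dot H (e z ord_max) (Ktilde H p j)| / `|e z ord_max|.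
(* After division by [|e z ord_max|], [s] bounds the numerator from above and [1 - t] bounds the
   norm of the orthogonal component from below. *)
pose s z := `|rkhs_dot H f (e z ord_max)| / `|e z ord_max|
  + \sum_j `|c j| * h j z.
pose t z := \sum_j M j * h j z.
have h0 j : h j @ to_boundary E --> (0 : Cplx R).
  apply: cvg_trans (ha j); apply: near_eq_cvg; apply: nearW => z /=.
  by rewrite norm_e gramE Ktilde_rcons.
have s0 : s @ to_boundary E --> (0 : Cplx R).
  rewrite -[X in _ --> X]addr0; apply: cvgD; last exact: cvg_sum_mul0.
  by under eq_fun do rewrite -norm_e.
have t0 : t @ to_boundary E --> (0 : Cplx R) by exact: cvg_sum_mul0.
have [sge0 tge0] : (forall z, 0 <= s z) /\ (forall z, 0 <= t z).
  split=> z; rewrite ?addr_ge0 ?divr_ge0 // sumr_ge0 // => j _;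
    by rewrite mulr_ge0 ?divr_ge0 ?sumr_ge0 // => k _; rewrite mulr_ge0.
have main z : E z ->
    `| `|f - fstar f (rcons_tuple p z)| - `|f - fstar f p| | * (1 - t z) <= s z.
  move=> Ez.
  have rE : forall k, E (tnth (rcons_tuple p z) k).
    move=> k; have [j ->|->] := unliftP ord_max k.
      by rewrite lift_ord_max tnth_rcons_widen.
    by rewrite tnth_rcons_max.
  have ie : lin_indep (e z) by move=> d /(indep _ _ rE).
  have e'E : (fun k => e z (widen_ord (leqnSn n) k)) = Ktilde H p.
    by apply/funext => k; exact: Ktilde_rcons.
  (* A zero last vector would contradict independence, tested on the indicator coefficients of
     [ord_max]. *)
  have egt0 : 0 < `|e z ord_max|.
    rewrite normr_gt0; apply/eqP => e0.
    have := ie (fun k => (k == ord_max)%:R); apply/not_implyP; split.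
      rewrite (bigD1 ord_max) //= e0 scaler0 add0r big1 // => k /negPf->.
      by rewrite scale0r.
    by move=> /(_ ord_max)/eqP; rewrite eqxx oner_eq0.
  have := gram_proj_recr_dist (@rkhs_normE _ _ _ H) f ie; rewrite e'E => D.
  rewrite -(ler_pM2r egt0) -mulrA mulrBl mul1r.
  have -> : t z * `|e z ord_max| =
      \sum_j M j * `|rkhs_dot H (e z ord_max) (Ktilde H p j)|.
    by rewrite mulr_suml; apply: eq_bigr => j _; rewrite -mulrA divfK ?gt_eqF.
  have -> : s z * `|e z ord_max| = `|rkhs_dot H f (e z ord_max)|
      + \sum_j `|c j| * `|rkhs_dot H (e z ord_max) (Ktilde H p j)|.
    rewrite mulrDl divfK ?gt_eqF // mulr_suml; congr (_ + _).
    by apply: eq_bigr => j _; rewrite -mulrA divfK ?gt_eqF.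
  apply: le_trans (dot_residual_le _ _ _ _); apply: le_trans D.
  by apply: ler_wpM2l => //; exact: norm_residual_ge.
apply/cvgrPdist_lt => eps eps0; near=> z.
(* Removing the empty compact set leaves [E] itself, so [E] belongs to the filter. *)
have Ez : E z by near: z; exists set0; [split=> //; exact: compact0|move=> ? []].
(* The choice [t z < 1 / 2] keeps [1 - t z] at least [1 / 2], so [main] costs a factor 2, absorbed
   by asking [s z < eps / 2]. *)
have st : s z < eps / 2.
  rewrite -[s z]ger0_norm // -[s z]subr0 distrC; near: z.
  by move/cvgrPdist_lt : s0; apply; rewrite divr_gt0.
have tt : t z < 1 / 2.
  rewrite -[t z]ger0_norm // -[t z]subr0 distrC; near: z.
  by move/cvgrPdist_lt : t0; apply; rewrite divr_gt0.
have t12 : 1 / 2 <= 1 - t z.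
  by rewrite lerBrDl [leRHS]splitr lerD2r ltW.
rewrite distrC -(@ltr_pM2r _ (1 / 2)) ?divr_gt0 //.
apply: le_lt_trans (_ : s z < _); last by rewrite mulrA mulr1.
by apply: le_trans (main z Ez); exact: ler_wpM2l.
Unshelve. all: by end_near.
Qed.
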